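(* Let $G$ be a $\mathfrak c$-bounded $P$-group, where $\mathfrak c$ is the cardinality of the continuum. Then $G$ is balanced if and only if it is functionally balanced.
   Context: All topological groups are assumed to be Hausdorff. A $P$-group is a topological group in which the intersection of countably many open sets is open. For an infinite cardinal $\tau$, a topological group $G$ is $\tau$-bounded if for every neighborhood $U$ of the identity there is a set $F\subseteq G$ with $|F|\le\tau$ and $FU=G$. The left uniformity $\mathcal L_G$ of a topological group $G$ has as base the sets $\{(x,y)\in G^2: x^{-1}y\in U\}$, and the right uniformity $\mathcal R_G$ has as base the sets $\{(x,y)\in G^2: xy^{-1}\in U\}$, where $U$ runs over the neighborhoods of the identity. $G$ is balanced if $\mathcal L_G=\mathcal R_G$. $G$ is functionally balanced if every bounded $\mathcal L_G$-uniformly continuous function $f:G\to\mathbb R$ is also $\mathcal R_G$-uniformly continuous. *)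

(* Defs.v *)
From HB Require Import structures.
From mathcomp Require Import all_boot all_order all_algebra.
From mathcomp Require Import all_classical all_reals all_analysis.

Set Implicit Arguments.
Unset Strict Implicit.
Unset Printing Implicit Defensive.

Import numFieldTopology.Exports numFieldNormedType.Exports.

Local Open Scope classical_set_scope.
Local Open Scope card_scope.

HB.structure Definition PreTopologicalGroup := {G of Topological G & Group G}.

HB.mixin Record PreTopologicalGroup_isTopologicalGroup G
    & PreTopologicalGroup G := {
  mulg_continuous : continuous (fun x : G * G => (x.1 * x.2)%g) ;
  invg_continuous : continuous (fun x : G => (x^-1)%g) ;
}.

(* Not assumed Hausdorff: separation is a separate hypothesis. *)
#[short(type="topologicalGroupType")]
HB.structure Definition TopologicalGroup :=
  {G of PreTopologicalGroup_isTopologicalGroup G & PreTopologicalGroup G}.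

Section Uniformities.
Variable G : topologicalGroupType.

Definition left_entourage : set_system (G * G) :=
  filter_from (nbhs (1%g : G)) (fun U => [set xy | U (xy.1^-1 * xy.2)%g]).

Definition right_entourage : set_system (G * G) :=
  filter_from (nbhs (1%g : G)) (fun U => [set xy | U (xy.1 * xy.2^-1)%g]).

Lemma cvg_mulg2 {T : Type} (F : set_system T) (FF : Filter F)
    (f g : T -> G) (a b : G) :
  f @ F --> a -> g @ F --> b -> (fun t => (f t * g t)%g) @ F --> (a * b)%g.
Proof.
move=> fa gb.
apply: (@cvg_comp _ _ _ (fun t => (f t, g t)) (fun x : G * G => x.1 * x.2)%g
  F (nbhs (a, b))); first exact: cvg_pair.
exact: (mulg_continuous (a, b)).
Qed.

Lemma nbhs1_inv (U : set G) : nbhs (1%g : G) U ->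
  nbhs (1%g : G) [set x | U (x^-1)%g].
Proof.
move=> U1; have : nbhs (1^-1 : G)%g U by rewrite invg1.
exact: invg_continuous.
Qed.

Lemma nbhs1_split (U : set G) : nbhs (1%g : G) U ->
  exists2 V, nbhs (1%g : G) V & forall x y, V x -> V y -> U (x * y)%g.
Proof.
move=> U1; have : nbhs (1 * 1 : G)%g U by rewrite mulg1.
move=> /(mulg_continuous (1%g, 1%g)) [[A B] /= [A1 B1] AB].
exists (A `&` B); first exact: filterI.
by move=> x y [Ax _] [_ By]; exact: (AB (x, y)).
Qed.

Lemma nbhs_mull (x : G) (U : set G) :
  nbhs (1%g : G) U -> nbhs x [set y | U (x^-1 * y)%g].
Proof.
move=> U1; have h : (fun y => x^-1 * y)%g @ x --> (x^-1 * x)%g.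
  by apply: cvg_mulg2; [exact: cvg_cst|exact: cvg_id].
by apply: h; rewrite mulVg.
Qed.

Lemma nbhs_mulVr (x : G) (U : set G) :
  nbhs (1%g : G) U -> nbhs x [set y | U (x * y^-1)%g].
Proof.
move=> U1; have h : (fun y => x * y^-1)%g @ x --> (x * x^-1)%g.
  by apply: cvg_mulg2; [exact: cvg_cst|exact: invg_continuous].
by apply: h; rewrite mulgV.
Qed.

Lemma left_entourage_filter : Filter left_entourage.
Proof.
apply: filter_from_filter; first by exists setT; exact: filterT.
by move=> U V U1 V1; exists (U `&` V); [exact: filterI|move=> xy []].
Qed.

Lemma left_entourage_diagonal A : left_entourage A -> diagonal `<=` A.
Proof.
move=> [U /nbhs_singleton U1 UA] [x y] /= xy.
by apply: UA; rewrite /= -[y]xy mulVg.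
Qed.

Lemma left_entourage_inv A : left_entourage A -> left_entourage A^-1%relation.
Proof.
move=> [U U1 UA]; exists [set x | U (x^-1)%g]; first exact: nbhs1_inv.
by move=> [x y] /=; rewrite invgM invgK => /(UA (y, x)).
Qed.

Lemma left_entourage_split A : left_entourage A ->
  exists2 B, left_entourage B & (B \; B `<=` A)%relation.
Proof.
move=> [U /nbhs1_split[V V1 VU] UA].
exists [set xy | V (xy.1^-1 * xy.2)%g]; first by exists V.
move=> [x y] [z /= xz zy]; apply: UA => /=.
by rewrite -(mulVKg z y) mulgA; exact: VU.
Qed.

Lemma left_nbhsE : nbhs = nbhs_ left_entourage.
Proof.
apply/funext => x; apply/seteqP; split => A.
  move=> xA; exists [set xy | A (x * (xy.1^-1 * xy.2))%g].
    exists [set z | A (x * z)%g] => //.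
    have h : (fun z => x * z)%g @ (1%g : G) --> (x * 1)%g.
      by apply: cvg_mulg2; [exact: cvg_cst|exact: cvg_id].
    by apply: h; rewrite mulg1.
  by move=> y /xsectionP /=; rewrite mulVKg.
move=> [B [U U1 UB] BA]; apply: filterS (nbhs_mull x U1) => y Uy.
by apply: BA; apply/xsectionP; exact: UB.
Qed.

Lemma right_entourage_filter : Filter right_entourage.
Proof.
apply: filter_from_filter; first by exists setT; exact: filterT.
by move=> U V U1 V1; exists (U `&` V); [exact: filterI|move=> xy []].
Qed.

Lemma right_entourage_diagonal A : right_entourage A -> diagonal `<=` A.
Proof.
move=> [U /nbhs_singleton U1 UA] [x y] /= xy.
by apply: UA; rewrite /= -[y]xy mulgV.
Qed.

Lemma right_entourage_inv A :
  right_entourage A -> right_entourage A^-1%relation.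
Proof.
move=> [U U1 UA]; exists [set x | U (x^-1)%g]; first exact: nbhs1_inv.
by move=> [x y] /=; rewrite invgM invgK => /(UA (y, x)).
Qed.

Lemma right_entourage_split A : right_entourage A ->
  exists2 B, right_entourage B & (B \; B `<=` A)%relation.
Proof.
move=> [U /nbhs1_split[V V1 VU] UA].
exists [set xy | V (xy.1 * xy.2^-1)%g]; first by exists V.
move=> [x y] [z /= xz zy]; apply: UA => /=.
by rewrite -(mulgVK z x) -mulgA; exact: VU.
Qed.

Lemma right_nbhsE : nbhs = nbhs_ right_entourage.
Proof.
apply/funext => x; apply/seteqP; split => A.
  move=> xA; exists [set xy | A ((xy.1 * xy.2^-1)^-1 * x)%g].
    exists [set z | A (z^-1 * x)%g] => //.
    have h : (fun z => z^-1 * x)%g @ (1%g : G) --> (1^-1 * x)%g.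
      by apply: cvg_mulg2; [exact: invg_continuous|exact: cvg_cst].
    by apply: h; rewrite invg1 mul1g.
  by move=> y /xsectionP /=; rewrite invgM invgK mulgVK.
move=> [B [U U1 UB] BA]; apply: filterS (nbhs_mulVr x U1) => y Uy.
by apply: BA; apply/xsectionP; exact: UB.
Qed.

(* Two aliases of the topological space G, since a type carries at most one
   canonical uniform structure. *)
Definition left_uniform : Type := G.
Definition right_uniform : Type := G.

HB.instance Definition _ := Topological.copy left_uniform G.
HB.instance Definition _ := Nbhs_isUniform_mixin.Build left_uniform
  left_entourage_filter left_entourage_diagonal left_entourage_inv
  left_entourage_split left_nbhsE.

HB.instance Definition _ := Topological.copy right_uniform G.
HB.instance Definition _ := Nbhs_isUniform_mixin.Build right_uniform
  right_entourage_filter right_entourage_diagonal right_entourage_inv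
  right_entourage_split right_nbhsE.

Definition balanced : Prop :=
  entourage (s := left_uniform) = entourage (s := right_uniform).

Definition functionally_balanced (R : realType) : Prop :=
  forall f : G -> R, bounded_fun f ->
    unif_continuous (f : left_uniform -> R) ->
    unif_continuous (f : right_uniform -> R).

Definition P_group : Prop :=
  forall A : nat -> set G, (forall n, open (A n)) -> open (\bigcap_n A n).

(* tau-boundedness, with the cardinal tau represented by a set K of that
   cardinality *)
Definition card_bounded (T : Type) (K : set T) : Prop :=
  forall U : set G, nbhs (1%g : G) U ->
    exists2 F : set G, F #<= K & [set (x * u)%g | x in F & u in U] = setT.

End Uniformities.

Arguments left_entourage G : clear implicits.
Arguments right_entourage G : clear implicits.

(* Main.v *)
(** In a P-group every neighborhood of the identity contains an open subgroup
    [H], and boundedness by the continuum says that [G/H] injects into the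
    reals. Composing the quotient map with a bounded injection gives a bounded
    [f] that is constant on the cosets [xH], hence left uniformly continuous,
    and separates them. If [f] is right uniformly continuous, intersecting the
    neighborhoods attached to each [1/(n+1)] yields a neighborhood [V] such that
    [x y^-1] in [V] forces [f x = f y], that is, [x^-1 y] in [H]. *)
Require Import Defs.
From mathcomp Require Import all_boot all_order all_algebra.
From mathcomp Require Import all_classical all_reals all_analysis.
Import Order.TTheory GRing.Theory Num.Theory.
Import numFieldTopology.Exports numFieldNormedType.Exports.
Local Open Scope classical_set_scope.

Lemma P_group_nbhs_bigcap (G : topologicalGroupType) (x : G) (U : nat -> set G) :
  P_group G -> (forall n, nbhs x (U n)) -> nbhs x (\bigcap_n U n).
Proof.
move=> PG Ux; apply: (@filterS _ _ _ (\bigcap_n (U n)°)).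
  by move=> y Uy n _; exact: interior_subset (Uy n I).
apply: open_nbhs_nbhs; split; first by apply: PG => n; exact: open_interior.
by move=> n _; exact: Ux.
Qed.

(** Iterating a choice of symmetric [V] inside [W] with [V * V] inside [W] gives a decreasing
    sequence of neighborhoods whose intersection is a subgroup; it stays a neighborhood because [G]
    is a P-group. *)
Lemma P_group_nbhs1_subgroup (G : topologicalGroupType) (U : set G) :
  P_group G -> nbhs (1%g : G) U ->
  exists H : set G, [/\ nbhs (1%g : G) H, H `<=` U,
    (forall x, H x -> H (x^-1)%g) & forall x y, H x -> H y -> H (x * y)%g].
Proof.
move=> PG U1.
have /choice[s sP] : forall W : set G, exists V : set G,
    nbhs (1%g : G) W -> [/\ nbhs (1%g : G) V, V `<=` W,
      (forall x, V x -> V (x^-1)%g) & forall x y, V x -> V y -> W (x * y)%g].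
  (* If [W] is not a neighborhood of the identity, the requirement is vacuous and [W] is a dummy
     value. *)
  move=> W; have [W1|] := pselect (nbhs (1%g : G) W); last by exists W.
  have [V V1 VW] := nbhs1_split W1.
  exists (V `&` [set x | V (x^-1)%g]) => _; split.
  - by apply: filterI => //; exact: nbhs1_inv.
  - by move=> x [Vx _]; rewrite -(mulg1 x); apply: VW => //; exact: nbhs_singleton.
  - by move=> x [Vx Vx1]; split => //=; rewrite invgK.
  - by move=> x y [Vx _] [Vy _]; exact: VW.
have itern n : nbhs (1%g : G) (iter n s U).
  by elim: n => //= n /sP[].
exists (\bigcap_n iter n s U); split.
- exact: P_group_nbhs_bigcap.
- by move=> x /(_ 0%N I).
- move=> x Hx n _; have [_ sW sV _] := sP _ (itern n).
  by apply/sW/sV; exact: (Hx n.+1 I).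
- move=> x y Hx Hy n _; have [_ _ _] := sP _ (itern n).
  by apply; [exact: (Hx n.+1 I)|exact: (Hy n.+1 I)].
Qed.

Lemma coset_separating_function (R : realType) (G : topologicalGroupType)
    (H : set G) :
  card_bounded G [set: R] -> nbhs (1%g : G) H ->
  (forall x, H x -> H (x^-1)%g) ->
  (forall x y, H x -> H y -> H (x * y)%g) ->
  exists2 f : G -> R, bounded_fun f &
    forall x y, f x = f y <-> H (x^-1 * y)%g.
Proof.
move=> cG H1 HV HM; have [F /pcard_leP[g] FH] := cG H H1.
pose reps x := [set a | F a /\ H (a^-1 * x)%g].
(* The default [1] is never taken: [F * H] is all of [G], so every [reps x] is inhabited. *)
pose rep x := xget 1%g (reps x).
have repsP x : reps x (rep x).
  have : [set: G] x by [].
  rewrite -FH => -[a Fa [h Hh ahx]].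
  by apply: (@xgetI _ _ _ a); split => //; rewrite -ahx mulKg.
(* [g] is injective on [F]; [atan] makes the values bounded without losing injectivity. *)
exists (fun x => atan (g (rep x))).
  exists (pi / 2)%R; split; first exact: num_real.
  move=> M piM x _; apply: le_trans (ltW piM).
  by rewrite ler_norml ltW ?atan_gtNpi2// ltW// atan_ltpi2.
move=> x y; split.
  move=> /(can_inj (@atanK R)) gxy.
  have [Fx Hx] := repsP x; have [Fy Hy] := repsP y.
  have exy : rep x = rep y.
    by apply: (@inj _ _ _ g) => //; exact/mem_set.
  rewrite -(mulVKg (rep x) y) mulgA.
  apply: HM; last by rewrite exy.
  by have := HV _ Hx; rewrite invgM invgK.
(* [xget] depends only on the set it chooses from, so it suffices that [reps x] and [reps y]
   coincide when [x] and [y] lie in the same coset. *)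
move=> Hxy; congr (atan (g (xget _ _))); apply/seteqP; split=> a [Fa Ha]; split=> //.
  by rewrite -(mulVKg x y) mulgA; exact: HM.
rewrite -(mulVKg y x) mulgA; apply: HM => //.
by have := HV _ Hxy; rewrite invgM invgK.
Qed.

(** Inversion exchanges the two uniformities, so one inclusion, read at [x^-1] and [y^-1], yields
    the other. *)
Lemma left_entourage_sub_right_balanced (G : topologicalGroupType) :
  left_entourage G `<=` right_entourage G -> balanced G.
Proof.
move=> LR; apply/seteqP; split; first exact: LR.
move=> A [U U1 UA].
have [V V1 VU] : right_entourage G [set xy | U (xy.1^-1 * xy.2)%g].
  by apply: LR; exists U.
exists V => // -[x y] /= Vxy; apply: UA => /=.
by have := VU (x^-1, y^-1)%g; rewrite /= !invgK; exact.
Qed.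

Lemma functionally_balanced_left_sub_right (R : realType)
    (G : topologicalGroupType) :
  P_group G -> card_bounded G [set: R] -> functionally_balanced G R ->
  left_entourage G `<=` right_entourage G.
Proof.
move=> PG cG fG A [U U1 UA].
have [H [H1 HU HV HM]] := P_group_nbhs1_subgroup _ _ PG U1.
have [f fb fH] := coset_separating_function _ _ _ cG H1 HV HM.
have fR : unif_continuous (f : right_uniform G -> R).
  apply: fG => // B B1; exists H => // -[x y] /= /fH fxy.
  by rewrite fxy; exact: entourage_refl.
have /choice[V VP] : forall n : nat, exists V : set G, nbhs (1%g : G) V /\
    forall x y, V (x * y^-1)%g -> (`|f x - f y| < n.+1%:R^-1)%R.
  move=> n; have n0 : (0 < n.+1%:R^-1 :> R)%R by rewrite invr_gt0.
  have [V V1 VB] := fR _ (entourage_ball R (PosNum n0)).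
  by exists V; split => // x y Vxy; exact: (VB (x, y)).
exists (\bigcap_n V n).
  by apply: P_group_nbhs_bigcap => // n; have [] := VP n.
move=> [x y] /= Vxy; apply/UA/HU/fH/eqP.
(* A nonzero distance between [f x] and [f y] would exceed some [1/(n+1)], against the choice of
   [V n]. *)
rewrite -subr_eq0 -normr_le0 leNgt; apply/negP => fxy0.
have [n _ /(_ n (leqnn n)) nf] := near_infty_natSinv_lt (PosNum fxy0).
by have [_ /(_ x y (Vxy n I)) /lt_trans /(_ nf)] := VP n; rewrite ltxx.
Qed.

Theorem theorem2p13 (R : realType) (G : topologicalGroupType) :
  hausdorff_space G ->
  P_group G ->
  card_bounded G [set: R] ->
  balanced G <-> functionally_balanced G R.
Proof.
move=> _ PG cG; split.
  move=> LR f _ fL B B1.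
  have : entourage (s := left_uniform G) [set xy | B (f xy.1, f xy.2)].
    exact: fL.
  by rewrite LR.
move=> fG; apply: left_entourage_sub_right_balanced.
exact: functionally_balanced_left_sub_right fG.
Qed.
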